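(* A pre Lie $n$-algebra $(V,\mathfrak p)$ is $n$-Lie admissible, that is, $$\mathfrak l(x_1,\dots,x_n):=\sum_{\sigma\in\mathbb{S}_n}sgn(\sigma)\,\mathfrak p(x_{\sigma(1)},\dots,x_{\sigma(n)})$$ is a Lie $n$-algebra structure on $V$.
   Context: All vector spaces are (ungraded) over a field $\mathbb{K}$ of characteristic $0$. $I_k$ is the identity of $\otimes^kV$. For $\sigma\in\mathbb{S}_k$, $\rho_\sigma(x_1\otimes\cdots\otimes x_k)=sgn(\sigma)\,x_{\sigma(1)}\otimes\cdots\otimes x_{\sigma(k)}$, extended linearly to $\mathbb{K}\mathbb{S}_k$; $w_k=\sum_{\sigma\in\mathbb{S}_k}\sigma$. For a vector space $V$ and linear $\mu:\otimes^nV\to V$, $(V,\mu)$ is: - a pre Lie $n$-algebra if $\mu=\mu\circ(\rho_\sigma\otimes I_1)$ for all $\sigma\in\mathbb{S}_{n-1}$ and $\sum_{i=0}^{n-1}\frac{(-1)^{i(n-1)}}{((n-1)!)^2}\mu\circ(I_i\otimes\mu\otimes I_{n-1-i})\circ(\rho_{w_{2n-2}}\otimes I_1)=0$; - a Lie $n$-algebra if $\mu=\mu\circ\rho_\sigma$ for all $\sigma\in\mathbb{S}_n$ and $\sum_{i=0}^{n-1}\frac{(-1)^{i(n-1)}}{(n-1)!\,n!}\mu\circ(I_i\otimes\mu\otimes I_{n-1-i})\circ\rho_{w_{2n-1}}=0$. *)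

(* Defs.v *)
From mathcomp Require Import all_boot all_algebra all_fingroup.

Set Implicit Arguments.
Unset Strict Implicit.
Unset Printing Implicit Defensive.

Import GRing.Theory.
Local Open Scope ring_scope.

(* A linear map from the k-th tensor power of V to W is represented by the    *)
(* corresponding multilinear map {ffun 'I_k -> V} -> W, the value at x being   *)
(* the value at the pure tensor x_0 (x) ... (x) x_(k-1).  A linear endomorphism *)
(* of a tensor power is represented through its action by precomposition.     *)
(* The arity n >= 1 of the structures is written m.+1, hence n - 1 = m,        *)
(* 2n - 2 = m.*2 and 2n - 1 = m.*2.+1.                                         *)

Section MultilinearOperations.

Variables (K : fieldType) (V : lmodType K).

Definition multilinear k (f : {ffun 'I_k -> V} -> V) : Prop :=
  forall (i : 'I_k) (x : {ffun 'I_k -> V}),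
    linear (fun v : V => f [ffun j => if j == i then v else x j]).

(* f o rho_s *)
Definition comp_rho k (f : {ffun 'I_k -> V} -> V) (s : 'S_k)
    (x : {ffun 'I_k -> V}) : V :=
  (-1) ^+ s *: f [ffun i => x (s i)].

(* f o (rho_s (x) I_1): s permutes the first k places, the last one is fixed *)
Definition comp_rho_I1 k (f : {ffun 'I_k.+1 -> V} -> V) (s : 'S_k)
    (x : {ffun 'I_k.+1 -> V}) : V :=
  (-1) ^+ s *: f [ffun i => x (lift_perm ord_max ord_max s i)].

(* f o rho_(w_k) and f o (rho_(w_k) (x) I_1) *)
Definition comp_rho_w k (f : {ffun 'I_k -> V} -> V)
    (x : {ffun 'I_k -> V}) : V :=
  \sum_(s : 'S_k) comp_rho f s x.

Definition comp_rho_w_I1 k (f : {ffun 'I_k.+1 -> V} -> V)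
    (x : {ffun 'I_k.+1 -> V}) : V :=
  \sum_(s : 'S_k) comp_rho_I1 f s x.

(* mu o (I_i (x) mu (x) I_(m-i)), that is                                     *)
(* mu (x_0, .., x_(i-1), mu (x_i, .., x_(i+m)), x_(i+m+1), .., x_(2m));        *)
(* the arguments of inord are always at most 2m.                              *)
Definition self_insert m (mu : {ffun 'I_m.+1 -> V} -> V) (i : 'I_m.+1)
    (x : {ffun 'I_m.*2.+1 -> V}) : V :=
  mu [ffun j : 'I_m.+1 =>
        if (j < i)%N then x (inord j)
        else if j == i then mu [ffun l : 'I_m.+1 => x (inord (i + l))]
        else x (inord (j + m))].

Definition pre_Lie_n_algebra m (mu : {ffun 'I_m.+1 -> V} -> V) : Prop :=
  [/\ multilinear mu,
      forall (s : 'S_m) (x : {ffun 'I_m.+1 -> V}), mu x = comp_rho_I1 mu s x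
    & forall x : {ffun 'I_m.*2.+1 -> V},
        \sum_(i < m.+1) ((-1) ^+ (i * m) / (m`!)%:R ^+ 2)
          *: comp_rho_w_I1 (self_insert mu i) x = 0].

Definition Lie_n_algebra m (mu : {ffun 'I_m.+1 -> V} -> V) : Prop :=
  [/\ multilinear mu,
      forall (s : 'S_m.+1) (x : {ffun 'I_m.+1 -> V}), mu x = comp_rho mu s x
    & forall x : {ffun 'I_m.*2.+1 -> V},
        \sum_(i < m.+1) ((-1) ^+ (i * m) / ((m`!)%:R * (m.+1`!)%:R))
          *: comp_rho_w (self_insert mu i) x = 0].

End MultilinearOperations.

(* Main.v *)
Require Import Defs.
From HB Require Import structures.
From mathcomp Require Import all_boot all_algebra all_fingroup.
From mathcomp Require Import zify.

(* Let [A] be the total antisymmetrization, n = m + 1, and f o_i g the         *)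
(* insertion of g in the i-th place of f.  As [A] absorbs permutations up to   *)
(* sign, A (l o_i l) = n! A (l o_i p), and expanding the outer l each sigma    *)
(* contributes (-1)^(m (i + k)) A (p o_k p) with k = sigma^-1 i: the block of  *)
(* n inner arguments behaves as a single letter, up to (-1)^m for each place   *)
(* it crosses.  Hence                                                          *)
(*   sum_i (-1)^(i m) A (l o_i l) = (n!)^2 sum_k (-1)^(k m) A (p o_k p),       *)
(* and (2m)! times the last sum is [A] applied to the pre-Lie relation.        *)

Set Implicit Arguments.
Unset Strict Implicit.
Unset Printing Implicit Defensive.

Import GRing.Theory.
Local Open Scope ring_scope.

(** The computation sketched above is carried by normalizing every insertion to [insert], where the
    inner arguments always come first; by [comp_rho_w_self_insert] this costs the sign (-1)^(i
    (m+1)). Then [comp_rho_w_insert_inner] and [comp_rho_w_insert_outer] remove the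
    antisymmetrization of the inner and of the outer factor, and [sum_comp_rho_w_self_insert]
    assembles them. Finally [comp_rho_w_w_I1] brings in the pre-Lie relation, and characteristic 0
    allows division by the factorials. *)

(** Transporting a decomposition of [s] into transpositions along [e] keeps their number, hence the
    sign. It lets permutations of the inner or outer arguments alone act on all 2m+1 places. *)
Lemma perm_extend (T U : finType) (e : T -> U) (s : {perm T}) :
  injective e ->
  exists t : {perm U}, [/\ odd_perm t = odd_perm s,
    forall a, t (e a) = e (s a) & forall b, b \notin codom e -> t b = b].
Proof.
move=> e_inj; have [ts -> dts] := prod_tpermP s.
elim: ts dts => [|[a b] ts IHts] /=.
  by exists 1%g; rewrite big_nil !odd_perm1; split=> // *; rewrite !perm1.
case/andP=> /= neq_ab /IHts[t [odd_t te t_id]].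
exists (tperm (e a) (e b) * t)%g; rewrite big_cons; split.
- by rewrite !odd_permM !odd_tperm odd_t (inj_eq e_inj).
- by move=> c; rewrite !permM -te (inj_tperm _ _ _ e_inj).
move=> c /[dup] /t_id tc nc; rewrite permM tpermD //;
  by apply: contraNneq nc => <-; apply: codom_f.
Qed.

(** Isolates the move of [i] to [s i], of sign (-1)^(i + s i), from the permutation [r] of the other
    places. *)
Lemma lift_permE n (i : 'I_n.+1) (s : 'S_n.+1) :
  exists r : 'S_n, s = lift_perm i (s i) r.
Proof.
have ex j : {r | s (lift i j) = lift (s i) r}.
  case: (unliftP (s i) (s (lift i j))) => [r -> | /perm_inj eq_ij].
    by exists r.
  by have := neq_lift i j; rewrite eq_ij eqxx.
have r_inj : injective (fun j => sval (ex j)).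
  move=> j j'; case: (ex j) (ex j') => [r sj] [r' sj'] /= eq_r.
  by apply/(@lift_inj _ i)/(@perm_inj _ s); rewrite sj sj' eq_r.
exists (perm r_inj); apply/permP=> j; case: (unliftP i j) => [j'|] ->.
  by rewrite lift_perm_lift permE; case: (ex j').
by rewrite lift_perm_id.
Qed.

Lemma natr_neq0_pchar0 (K : fieldType) n :
  [pchar K] =i pred0 -> (0 < n)%N -> n%:R != 0 :> K.
Proof. by move=> /pcharf0P-> n_gt0; rewrite -lt0n. Qed.

(** * The antisymmetrizer [comp_rho_w] and its absorption of permutations *)

Section Antisymmetrization.

Variables (K : fieldType) (V : lmodType K).

Lemma eq_comp_rho_w k (f g : {ffun 'I_k -> V} -> V) :
  f =1 g -> comp_rho_w f =1 comp_rho_w g.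
Proof. by move=> fg x; apply: eq_bigr => s _; rewrite /comp_rho fg. Qed.

Lemma comp_rho_w_lin k (I : finType) (c : I -> K)
    (f : I -> {ffun 'I_k -> V} -> V) x :
  comp_rho_w (fun y => \sum_i c i *: f i y) x
    = \sum_i c i *: comp_rho_w (f i) x.
Proof.
rewrite /comp_rho_w; under [RHS]eq_bigr do rewrite scaler_sumr.
rewrite exchange_big; apply: eq_bigr => s _.
rewrite /comp_rho scaler_sumr; apply: eq_bigr => i _.
by rewrite !scalerA mulrC.
Qed.

Lemma comp_rho_w_rho k (f : {ffun 'I_k -> V} -> V) s x :
  comp_rho_w (comp_rho f s) x = comp_rho_w f x.
Proof.
rewrite /comp_rho_w [RHS](reindex_inj (mulgI s)); apply: eq_bigr => t _.
rewrite /comp_rho scalerA -signr_addb odd_permM addbC; congr (_ *: f _).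
by apply/ffunP=> i; rewrite !ffunE permM.
Qed.

(** Up to the sign of [t], [f] is [comp_rho g t], and antisymmetrization absorbs that twist. All
    later signs arise this way. *)
Lemma comp_rho_w_perm k (f g : {ffun 'I_k -> V} -> V) (t : 'S_k) x :
  (forall y, f y = g [ffun i => y (t i)]) ->
  comp_rho_w f x = (-1) ^+ t *: comp_rho_w g x.
Proof.
move=> fg; rewrite -(comp_rho_w_rho g t) scaler_sumr.
apply: eq_bigr => s _; rewrite /comp_rho fg !scalerA mulrAC.
by rewrite -signr_addb addbb mul1r.
Qed.

(** Each of the k! terms of the partial antisymmetrization is a twist by a permutation fixing the
    last place, so each contributes the same. *)
Lemma comp_rho_w_w_I1 k (f : {ffun 'I_k.+1 -> V} -> V) x :
  comp_rho_w (comp_rho_w_I1 f) x = k`!%:R *: comp_rho_w f x.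
Proof.
transitivity (\sum_(s : 'S_k) 1 *: comp_rho_w (comp_rho_I1 f s) x).
  rewrite -comp_rho_w_lin; apply: eq_comp_rho_w => y.
  by apply: eq_bigr => s _; rewrite scale1r.
rewrite (eq_bigr (fun=> comp_rho_w f x)) => [|s _].
  by rewrite sumr_const card_Sn scaler_nat.
rewrite scale1r -(comp_rho_w_rho f (lift_perm ord_max ord_max s)).
by apply: eq_comp_rho_w => y; rewrite /comp_rho odd_lift_perm addbb.
Qed.

Lemma comp_rho_comp_rho_w k (f : {ffun 'I_k -> V} -> V) s x :
  comp_rho (comp_rho_w f) s x = comp_rho_w f x.
Proof.
rewrite /comp_rho scaler_sumr [RHS](reindex_inj (mulIg s)).
apply: eq_bigr => t _.
rewrite /comp_rho scalerA -signr_addb odd_permM addbC; congr (_ *: f _).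
by apply/ffunP=> i; rewrite !ffunE permM.
Qed.

Lemma multilinear_comp_rho_w k (f : {ffun 'I_k -> V} -> V) :
  multilinear f -> multilinear (comp_rho_w f).
Proof.
move=> f_lin i x a u v; rewrite /comp_rho_w scaler_sumr -big_split.
apply: eq_bigr => s _ /=; rewrite /comp_rho.
have slot w : [ffun j => [ffun j' => if j' == i then w else x j'] (s j)]
    = [ffun j => if j == (s^-1)%g i then w else [ffun j' => x (s j')] j].
  by apply/ffunP=> j; rewrite !ffunE (canF_eq (permK s)).
by rewrite !slot f_lin scalerDr !scalerA mulrC.
Qed.

Lemma multilinear_sum k (f : {ffun 'I_k -> V} -> V) i
    (x : {ffun 'I_k -> V}) (I : finType)
    (c : I -> K) (v : I -> V) : multilinear f ->
  f [ffun j => if j == i then \sum_r c r *: v r else x j]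
    = \sum_r c r *: f [ffun j => if j == i then v r else x j].
Proof.
move=> f_lin; pose F w := f [ffun j => if j == i then w else x j].
have F_lin : linear F by exact: f_lin.
pose L : {linear V -> V} :=
  HB.pack F (GRing.isLinear.Build K V V *:%R F F_lin).
rewrite -/(F _) -[LHS]/(L _) linear_sum.
by apply: eq_bigr => r _; rewrite linearZ.
Qed.

(** * Signs of insertions under antisymmetrization *)

Section Insertion.

Variable m : nat.
Implicit Types f g p : {ffun 'I_m.+1 -> V} -> V.

(* In f o_i g, the places of the arguments of f other than the i-th, and of    *)
(* the arguments of g.                                                         *)
Definition outer (i : nat) (j : 'I_m) : 'I_m.*2.+1 :=
  inord (if j < i then j : nat else j + m.+1)%N.
Definition inner (i : nat) (l : 'I_m.+1) : 'I_m.*2.+1 := inord (i + l)%N.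

Lemma val_outer i j :
  val (outer i j) = (if j < i then j : nat else j + m.+1)%N.
Proof. by have lt_jm := ltn_ord j; rewrite /= inordK //; case: ifP; lia. Qed.

Lemma val_inner i l : (i <= m)%N -> val (inner i l) = (i + l)%N.
Proof. by have lt_lm := ltn_ord l; move=> le_im; rewrite /= inordK //; lia. Qed.

(* The arguments of g come first, whatever i is. *)
Definition insert f g (i : 'I_m.+1) (x : {ffun 'I_m.*2.+1 -> V}) : V :=
  f [ffun j => oapp (fun j' => x (outer 0 j'))
                    (g [ffun l => x (inner 0 l)]) (unlift i j)].

Lemma insert_shift i : (i <= m)%N ->
  exists t : 'S_m.*2.+1, [/\ odd_perm t = odd (i * m.+1),
    forall j, t (outer 0 j) = outer i j & forall l, t (inner 0 l) = inner i l].
Proof.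
elim: i => [_ | i IHi lt_im].
  by exists 1%g; rewrite odd_perm1; split=> // ?; rewrite perm1.
have [t [odd_t t_outer t_inner]] := IHi (ltnW lt_im).
pose a : 'I_m.*2.+1 := inord (i + m.+1); pose b : 'I_m.*2.+1 := inord i.
have va : val a = (i + m.+1)%N by rewrite /= inordK //; lia.
have vb : val b = i by rewrite /= inordK //; lia.
(* [r] is the cycle that brings the argument just after the inner block to just before it. The block
   of m+1 letters moves up by one, whence the sign (-1)^(m+1). *)
pose r := lift_perm a b 1.
have ra : r a = b by exact: lift_perm_id.
have r_val c : c != a -> val (r c) = bump i (unbump (i + m.+1) (val c)).
  case: (unliftP a c) => [c' ->|->]; last by rewrite eqxx.
  by rewrite lift_perm_lift perm1 /= va vb bumpK.
exists (t * r)%g; split=> [|j|l].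
- rewrite odd_permM odd_t odd_lift_perm odd_perm1 va vb.
  by rewrite addbF mulSn !oddD [odd i (+) _]addbC addbK addbC.
- rewrite permM t_outer; have [eq_a | /[dup] neq_a /r_val] := eqVneq (outer i j) a.
    rewrite eq_a ra; apply: val_inj; rewrite vb val_outer.
    by move/(congr1 val): eq_a; rewrite va val_outer; case: ifP; case: ifP; lia.
  have {}neq_a : val (outer i j) != val a by [].
  move=> rE; apply: val_inj; rewrite rE; move: neq_a.
  rewrite !val_outer va /bump /unbump; have := ltn_ord j.
  by case: ifP; case: ifP; lia.
have lt_l := ltn_ord l.
rewrite permM t_inner; apply: val_inj; rewrite r_val ?val_inner /bump /unbump; try lia.
by apply/eqP=> /(congr1 val); rewrite va val_inner; lia.
Qed.

Lemma self_insertE p (i : 'I_m.+1) (t : 'S_m.*2.+1) x :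
    (forall j, t (outer 0 j) = outer i j) ->
    (forall l, t (inner 0 l) = inner i l) ->
  self_insert p i x = insert p p i [ffun j => x (t j)].
Proof.
move=> t_outer t_inner; congr p; apply/ffunP=> j; rewrite !ffunE.
case: (unliftP i j) => [j'|] -> /=; last first.
  rewrite ltnn eqxx; congr p; apply/ffunP=> l.
  by rewrite !ffunE t_inner.
rewrite [_ == i]eq_sym (negPf (neq_lift _ _)) ffunE t_outer /outer /= /bump.
have [lt_ji | le_ij] := ltnP j' i.
  by rewrite add0n lt_ji.
by rewrite add1n addSnnS ltnNge (leqW le_ij).
Qed.

Lemma comp_rho_w_self_insert p (i : 'I_m.+1) x :
  comp_rho_w (self_insert p i) x
    = (-1) ^+ (i * m.+1) *: comp_rho_w (insert p p i) x.
Proof.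
have [t [odd_t t_outer t_inner]] := insert_shift (ltn_ord i : (i <= m)%N).
rewrite -signr_odd -odd_t; apply: comp_rho_w_perm => y.
exact: self_insertE.
Qed.

Lemma insert_comp_rho_w f g i x : multilinear f ->
  insert f (comp_rho_w g) i x
    = \sum_(s : 'S_m.+1)
        (-1) ^+ s *: insert f (fun w => g [ffun l => w (s l)]) i x.
Proof.
(* The 0 is a placeholder at place [i], which [slot] overwrites. *)
move=> f_lin; pose u := [ffun j => oapp (fun j' => x (outer 0 j')) 0 (unlift i j)].
have slot h : insert f h i x
    = f [ffun j => if j == i then h [ffun l => x (inner 0 l)] else u j].
  congr f; apply/ffunP=> j; rewrite !ffunE.
  by case: (unliftP i j) => [j'|] -> /=;
    rewrite ?eqxx // eq_sym (negPf (neq_lift _ _)).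
rewrite slot multilinear_sum //.
by apply: eq_bigr => s _; rewrite slot.
Qed.

Lemma outer_inner i j l : (i <= m)%N -> outer i j != inner i l.
Proof.
move=> le_im; apply/eqP=> /(congr1 val); rewrite val_outer val_inner //.
by have := ltn_ord l; case: ifP; lia.
Qed.

Lemma outer_inj i : injective (outer i).
Proof.
move=> j j' /(congr1 val); rewrite !val_outer => eq_j; apply: val_inj => /=.
by move: eq_j; have := ltn_ord j; have := ltn_ord j'; case: ifP; case: ifP; lia.
Qed.

Lemma inner_inj i : (i <= m)%N -> injective (inner i).
Proof.
move=> le_im l l' /(congr1 val); rewrite !val_inner // => /addnI eq_l.
exact: val_inj.
Qed.

(** Linearity of [f] in place [i] pulls out the sum over [s]. Extending [s] by the identity on the
    outer places produces its sign a second time, so all (m+1)! terms agree. *)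
Lemma comp_rho_w_insert_inner f g i x : multilinear f ->
  comp_rho_w (insert f (comp_rho_w g) i) x
    = m.+1`!%:R *: comp_rho_w (insert f g i) x.
Proof.
move=> f_lin; rewrite (eq_comp_rho_w (fun y => insert_comp_rho_w g i y f_lin)).
rewrite comp_rho_w_lin (eq_bigr (fun=> comp_rho_w (insert f g i) x)).
  by rewrite sumr_const card_Sn scaler_nat.
move=> s _.
have [t [odd_t t_inner t_id]] := perm_extend s (@inner_inj 0 isT).
rewrite (@comp_rho_w_perm _ _ (insert f g i) t) => [|y].
  by rewrite odd_t scalerA -signr_addb addbb scale1r.
congr f; apply/ffunP=> j; rewrite !ffunE; case: (unlift i j) => [j'|] /=.
  rewrite ffunE t_id //; apply/codomP=> -[l eq_l].
  by have := @outer_inner 0 j' l isT; rewrite eq_l eqxx.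
by congr g; apply/ffunP=> l; rewrite !ffunE t_inner.
Qed.

(** In the term of [s], the value of [g] lands in place k = s^-1 i of [p]. The rest [r] of [s]
    permutes outer arguments only and is absorbed with its sign, so only the sign (-1)^(i + k) of
    the move from k to i survives. *)
Lemma comp_rho_w_insert_outer p g i x :
  comp_rho_w (insert (comp_rho_w p) g i) x
    = \sum_(s : 'S_m.+1)
        (-1) ^+ (i + (s^-1)%g i) *: comp_rho_w (insert p g ((s^-1)%g i)) x.
Proof.
transitivity (comp_rho_w (fun y => \sum_(s : 'S_m.+1)
    (-1) ^+ s *: insert (fun z => p [ffun j => z (s j)]) g i y) x).
  by apply: eq_comp_rho_w => y.
rewrite comp_rho_w_lin; apply: eq_bigr => s _.
set k := (s^-1)%g i; have [r ds] := lift_permE k s.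
have sk : s k = i by rewrite permKV.
rewrite sk in ds.
have [t [odd_t t_outer t_id]] := perm_extend r (@outer_inj 0).
rewrite (@comp_rho_w_perm _ _ (insert p g k) t) => [|y].
  rewrite scalerA odd_t {1}ds odd_lift_perm signr_addb -mulrA -signr_addb.
  by rewrite addbb mulr1 signr_addb !signr_odd exprD mulrC.
congr p; apply/ffunP=> j; rewrite !ffunE.
case: (unliftP k j) => [j'|] ->.
  by rewrite ds lift_perm_lift liftK /= ffunE t_outer.
rewrite sk !unlift_none /=; congr g; apply/ffunP=> l; rewrite !ffunE t_id //.
by apply/codomP=> -[j' eq_j']; have := @outer_inner 0 j' l isT; rewrite eq_j' eqxx.
Qed.

Lemma sum_comp_rho_w_self_insert p x : multilinear p ->
  \sum_(i < m.+1) (-1) ^+ (i * m)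
      *: comp_rho_w (self_insert (comp_rho_w p) i) x
    = (m.+1`!%:R ^+ 2) *: \sum_(i < m.+1) (-1) ^+ (i * m)
      *: comp_rho_w (self_insert p i) x.
Proof.
move=> p_lin; have l_lin := multilinear_comp_rho_w p_lin.
have sign i : (-1) ^+ (i * m) * (-1) ^+ (i * m.+1) = (-1) ^+ i :> K.
  by rewrite mulnS mulrC exprD -mulrA -expr2 sqrr_sign mulr1.
pose B i := comp_rho_w (insert p p i) x.
transitivity (m.+1`!%:R *: \sum_(i < m.+1) \sum_(s : 'S_m.+1)
    (-1) ^+ (s^-1)%g i *: B ((s^-1)%g i)).
  rewrite scaler_sumr; apply: eq_bigr => i _.
  rewrite comp_rho_w_self_insert scalerA sign comp_rho_w_insert_inner //.
  rewrite comp_rho_w_insert_outer scalerA mulrC -scalerA; congr (_ *: _).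
  rewrite scaler_sumr; apply: eq_bigr => s _.
  by rewrite scalerA exprD signrMK.
rewrite exchange_big expr2 -scalerA; congr (_ *: _).
rewrite scaler_nat -card_Sn -sumr_const.
(* Substituting [s i] for [i] makes the inner sum independent of [s]; this gives the second
   (m+1)!. *)
apply: eq_bigr => s _; rewrite (reindex_inj (@perm_inj _ s)).
apply: eq_bigr => i _.
by rewrite permK comp_rho_w_self_insert scalerA sign.
Qed.

End Insertion.
End Antisymmetrization.

Theorem corollary4p6 (K : fieldType) (charK0 : [pchar K] =i pred0)
    (V : lmodType K) (m : nat) (p : {ffun 'I_m.+1 -> V} -> V)
    (p_preLie : pre_Lie_n_algebra p) :
  Lie_n_algebra (fun x : {ffun 'I_m.+1 -> V} =>
    \sum_(s : 'S_m.+1) (-1) ^+ s *: p [ffun i => x (s i)]).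
Proof.
have fact_neq0 k : k`!%:R != 0 :> K by rewrite natr_neq0_pchar0 ?fact_gt0.
have [p_lin _ preLie] := p_preLie; rewrite -/(comp_rho_w p).
split=> [|s x|x]; first exact: multilinear_comp_rho_w.
  by rewrite comp_rho_comp_rho_w.
(* [q] is the left side of the pre-Lie relation, to be antisymmetrized over all 2m+1 arguments. *)
pose q y := \sum_(i < m.+1) ((-1) ^+ (i * m) / m`!%:R ^+ 2)
  *: comp_rho_w_I1 (self_insert p i) y.
have : comp_rho_w q x = 0.
  by rewrite /comp_rho_w big1 // => s _; rewrite /comp_rho /q preLie scaler0.
rewrite /q comp_rho_w_lin.
under eq_bigr do rewrite comp_rho_w_w_I1 scalerA -mulrA mulrC -scalerA.
(* The common scalar (2m)! / (m!)^2 is nonzero in characteristic 0, so the alternating sum itself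
   vanishes. *)
rewrite -scaler_sumr => /eqP; rewrite scaler_eq0 mulf_eq0 invr_eq0.
rewrite expf_eq0 !(negPf (fact_neq0 _)) /= => /eqP preLie_alt.
under eq_bigr do rewrite mulrC -scalerA.
by rewrite -scaler_sumr sum_comp_rho_w_self_insert // preLie_alt !scaler0.
Qed.
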